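(* Let $\{x_k\}_{k\ge 0}$ be generated by the time-varying gradient descent (TVGD) recursion $x_{k+1}=x_k-\beta\nabla_x f(x_k;t_k)$ from an arbitrary $x_0\in\mathbb{R}^d$, with step size $\beta=1/L_1$. Suppose that (1) $f(\cdot;t)$ is twice differentiable with $\|\nabla_{xx}f(x;t)\|\le L_1$ for all $x\in\mathbb{R}^d$, $t\ge 0$; (2) there exists a function $\mathscr{G}:\mathbb{R}\to\mathbb{R}$ such that $|[f(x;s)-\mathscr{G}(s)]-[f(x;t)-\mathscr{G}(t)]|\le G_2|s-t|$ for all $x\in\mathbb{R}^d$ and all $s,t\ge 0$. Then for every $k_0\in\mathbb{Z}_{\ge 0}$, with $T_{k_0}:=\dfrac{f_{k_0}-f_{k_0}^\ast}{2h}$ (assumed to be a positive integer, so that the following sum makes sense), $$\frac{1}{T_{k_0}}\sum_{k=k_0}^{k_0+T_{k_0}-1}\|\nabla_x f(x_k;t_k)\|\le 2\sqrt{L_1(1+G_2)h}.$$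
   Context: $f:\mathbb{R}^d\times\mathbb{R}\to\mathbb{R}$, $(x,t)\mapsto f(x;t)$, is a time-varying objective function; $h>0$ is the sampling period and $t_k:=kh$. For each $t\ge0$ the problem $\min_{x\in\mathbb{R}^d}f(x;t)$ is assumed to have an optimal solution $x^\ast(t)$; $f_k^\ast:=\min_{x}f(x;t_k)$ is the optimal value at time $t_k$, and $f_k:=f(x_k;t_k)$. $\nabla_x$ denotes the gradient and $\nabla_{xx}$ the Hessian in $x$; $\|\cdot\|$ is the Euclidean norm for vectors and the operator norm for matrices. $L_1>0$ and $G_2\ge 0$ are constants. (The general TVGD algorithm performs $C$ gradient steps per time step; the number of steps here is $C=1$.) *)

(* Defs.v *)
From HB Require Import structures.
From mathcomp Require Import all_boot all_order all_algebra.
From mathcomp Require Import all_classical all_reals all_analysis.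

Set Implicit Arguments.
Unset Strict Implicit.
Unset Printing Implicit Defensive.

Import Order.TTheory GRing.Theory Num.Theory.
Import numFieldNormedType.Exports.

Local Open Scope classical_set_scope.
Local Open Scope ring_scope.

(* The library norm `|x| on 'rV[R]_d is the sup norm, so the Euclidean norm is
   introduced separately.  The two are equivalent, so [differentiable] below
   has its usual meaning. *)
Definition enorm (R : realType) (d : nat) (x : 'rV[R]_d) : R :=
  Num.sqrt (\sum_(i < d) x 0 i ^+ 2).

(* Operator norm for the Euclidean norm.  A matrix acts on row vectors on the
   right, as for 'J.  The set is nonempty and bounded, so the supremum is
   not the default value of [sup]. *)
Definition opnorm (R : realType) (d : nat) (A : 'M[R]_d) : R :=
  sup [set enorm (v *m A) | v in [set v : 'rV[R]_d | enorm v <= 1]].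

Definition gradient (R : realType) (d : nat) (g : 'rV[R]_d -> R)
    (x : 'rV[R]_d) : 'rV[R]_d :=
  \row_(i < d) 'D_(delta_mx 0 i) g x.

Definition hessian (R : realType) (d : nat) (g : 'rV[R]_d -> R)
    (x : 'rV[R]_d) : 'M[R]_d :=
  'J (gradient g) x.

Definition twice_differentiable (R : realType) (d : nat)
    (g : 'rV[R]_d -> R) : Prop :=
  (forall x, differentiable g x) /\ (forall x, differentiable (gradient g) x).

Definition tvgd (R : realType) (d : nat) (f : 'rV[R]_d -> R -> R)
    (h beta : R) (x : nat -> 'rV[R]_d) : Prop :=
  forall k : nat,
    x k.+1 = x k - beta *: gradient (fun y => f y (k%:R * h)) (x k).

(* Main.v *)
(* The Hessian bound gives the descent lemma, so one step with beta = 1/L1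
   decreases f(.;t_k) by at least |grad|^2 / (2 L1).  The quantity f - G drifts
   by at most G2 h per sampling period, uniformly in x, so telescoping f_k - G(t_k)
   over T steps and comparing with the minimum at time t_k0 (again up to a drift
   G2 h T) gives
     sum |grad_k|^2 / (2 L1) <= (f_k0 - f_k0^* ) + 2 G2 h T = 2 (1 + G2) h T.
   Cauchy-Schwarz then bounds the mean of |grad_k|. *)
Require Import Defs.
From mathcomp Require Import all_boot all_order all_algebra.
From mathcomp Require Import all_classical all_reals all_analysis.
From mathcomp Require Import ring lra.

Import Order.TTheory GRing.Theory Num.Theory.
Import numFieldNormedType.Exports.

Local Open Scope ring_scope.

(** Lagrange's identity: twice the gap is the double sum of the squares
    [(a i * b j - a j * b i) ^+ 2], so no division or square root is needed. *)
Lemma sum_cauchy_schwarz {R : realDomainType} {I : Type} (r : seq I)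
    (a b : I -> R) :
  (\sum_(i <- r) a i * b i) ^+ 2 <=
  (\sum_(i <- r) a i ^+ 2) * (\sum_(i <- r) b i ^+ 2).
Proof.
suff: 0 <= 2 * ((\sum_(i <- r) a i ^+ 2) * (\sum_(i <- r) b i ^+ 2) -
                (\sum_(i <- r) a i * b i) ^+ 2).
  by rewrite pmulr_rge0// subr_ge0.
have -> : 2 * ((\sum_(i <- r) a i ^+ 2) * (\sum_(i <- r) b i ^+ 2) -
                (\sum_(i <- r) a i * b i) ^+ 2) =
    \sum_(i <- r) \sum_(j <- r) (a i * b j - a j * b i) ^+ 2.
  transitivity (\sum_(i <- r) (a i ^+ 2 * (\sum_(j <- r) b j ^+ 2)
      - 2 * (a i * b i) * (\sum_(j <- r) a j * b j)
      + b i ^+ 2 * (\sum_(j <- r) a j ^+ 2))); last first.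
    apply: eq_bigr => i _; rewrite !mulr_sumr -sumrB -big_split/=.
    by apply: eq_bigr => j _; ring.
  rewrite big_split sumrB/= -!mulr_suml -mulr_sumr; ring.
by apply: sumr_ge0 => i _; apply: sumr_ge0 => j _; exact: sqr_ge0.
Qed.

Definition dotrv {R : realType} {d : nat} (u v : 'rV[R]_d) : R :=
  \sum_(i < d) u 0 i * v 0 i.

Lemma enorm_ge0 {R : realType} {d : nat} (u : 'rV[R]_d) : 0 <= enorm u.
Proof. exact: sqrtr_ge0. Qed.

Lemma sqr_enorm {R : realType} {d : nat} (u : 'rV[R]_d) : enorm u ^+ 2 = dotrv u u.
Proof. by rewrite sqr_sqrtr// sumr_ge0// => i _; exact: sqr_ge0. Qed.

Lemma enormZ {R : realType} {d : nat} (c : R) (u : 'rV[R]_d) :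
  enorm (c *: u) = `|c| * enorm u.
Proof.
rewrite /enorm -sqrtr_sqr -sqrtrM ?sqr_ge0// mulr_sumr.
by under eq_bigr do rewrite mxE exprMn.
Qed.

Lemma enorm_eq0 {R : realType} {d : nat} (u : 'rV[R]_d) : enorm u = 0 -> u = 0.
Proof.
move=> u0; have : dotrv u u = 0 by rewrite -sqr_enorm u0 expr0n.
move=> /psumr_eq0P uu; apply/rowP => i; rewrite mxE.
by apply/eqP; rewrite -sqrf_eq0 expr2 uu// => j _; rewrite -expr2 sqr_ge0.
Qed.

Lemma dotrv_le {R : realType} {d : nat} (u v : 'rV[R]_d) :
  dotrv u v <= enorm u * enorm v.
Proof.
apply: le_trans (ler_norm _) _.
rewrite -(@ler_pXn2r _ 2)// ?nnegrE ?mulr_ge0 ?enorm_ge0//.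
rewrite real_normK ?num_real// exprMn !sqr_enorm.
exact: sum_cauchy_schwarz.
Qed.

(** Cauchy-Schwarz in each column. This Frobenius bound serves to show that the set whose supremum
    is [opnorm A] is bounded above. *)
Lemma enorm_mulmx_le {R : realType} {d : nat} (A : 'M[R]_d) (v : 'rV[R]_d) :
  enorm (v *m A) <= enorm v * Num.sqrt (\sum_(j < d) \sum_(i < d) A i j ^+ 2).
Proof.
rewrite /enorm -sqrtrM ?sumr_ge0// => [|i _]; last exact: sqr_ge0.
rewrite ler_wsqrtr// mulr_sumr ler_sum// => j _; rewrite mxE.
exact: sum_cauchy_schwarz.
Qed.

Lemma enorm_mulmx_opnorm {R : realType} {d : nat} (A : 'M[R]_d) (v : 'rV[R]_d) :
  enorm (v *m A) <= opnorm A * enorm v.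
Proof.
have [v0|v0] := eqVneq (enorm v) 0.
  by rewrite v0 (enorm_eq0 _ v0) mul0mx mulr0 /enorm big1 ?sqrtr0// => i _;
     rewrite mxE expr0n.
have vgt0 : 0 < enorm v by rewrite lt_neqAle eq_sym v0 enorm_ge0.
rewrite -ler_pdivrMr// mulrC -[_^-1]ger0_norm ?invr_ge0 ?enorm_ge0//.
rewrite -enormZ scalemxAl; apply: ub_le_sup.
  exists (Num.sqrt (\sum_(j < d) \sum_(i < d) A i j ^+ 2)) => _ [w /= w1 <-].
  by rewrite (le_trans (enorm_mulmx_le _ _))// ler_piMl// sqrtr_ge0.
exists ((enorm v)^-1 *: v) => //=.
by rewrite enormZ ger0_norm ?invr_ge0 ?enorm_ge0// mulVf.
Qed.

(** The two difference quotients coincide. This turns directional derivatives into derivatives in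
    one real variable, to which the mean value theorem applies. *)
Lemma is_derive_line {R : realType} {V W : normedModType R} (F : V -> W)
    (x v : V) (s : R) :
  derivable F (x + s *: v) v ->
  is_derive s 1 (fun r : R => F (x + r *: v)) ('D_v F (x + s *: v)).
Proof.
have E : (fun h : R => h^-1 *: (((fun r : R => F (x + r *: v)) \o shift s) (h *: 1)
            - F (x + s *: v))) =
         (fun h : R => h^-1 *: ((F \o shift (x + s *: v)) (h *: v) - F (x + s *: v))).
  apply/funext => h /=; congr (_ *: (F _ - _)).
  by rewrite [h *: 1]mulr1 scalerDl addrCA.
by move=> dF; apply: DeriveDef; rewrite /derivable /derive E.
Qed.

(** Differentiability makes the derivative linear in the direction, so [v] may be expanded in the
    standard basis. *)
Lemma derive_gradient {R : realType} {d : nat} (g : 'rV[R]_d -> R)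
    (x v : 'rV[R]_d) :
  differentiable g x -> 'D_v g x = dotrv v (gradient g x).
Proof.
move=> dg; rewrite deriveE// [v in LHS]row_sum_delta linear_sum.
by apply: eq_bigr => i _; rewrite linearZ/= mxE deriveE.
Qed.

Lemma is_derive_dotrv {R : realType} {V : normedModType R} {d : nat}
    (u : 'rV[R]_d) (F : V -> 'rV[R]_d) (x v : V) :
  derivable F x v ->
  is_derive x v (fun y => dotrv u (F y)) (dotrv u ('D_v F x)).
Proof.
move=> dF.
have -> : (fun y => dotrv u (F y)) =
    \sum_(i < d) (u 0 i \*: (fun y => F y 0 i)).
  by apply/funext => y; rewrite fct_sumE.
have dFi i : derivable (fun y => F y 0 i) x v by move/derivable_mxP : dF; exact.
have -> : dotrv u ('D_v F x) =
    \sum_(i < d) u 0 i *: 'D_v (fun y => F y 0 i) x.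
  by apply: eq_bigr => i _; rewrite derive_mx// mxE.
apply: is_derive_sum => i; apply: is_deriveZ; exact: DeriveDef.
Qed.

Lemma descent_lemma {R : realType} {d : nat} (g : 'rV[R]_d -> R) (L : R)
    (x v : 'rV[R]_d) :
  twice_differentiable g -> (forall y, opnorm (hessian g y) <= L) ->
  g (x + v) <= g x + dotrv v (gradient g x) + L / 2 * enorm v ^+ 2.
Proof.
move=> [dg ddg] HL.
(* The gradient need not be C^1, so the second-order bound comes from two
   applications of the mean value theorem along the segment. *)
pose Q := L * enorm v ^+ 2.
pose p1 (s : R) := dotrv v (gradient g (x + s *: v)).
have dp1 (s : R) : is_derive s 1 p1
    (dotrv v (v *m hessian g (x + s *: v))).
  have dG : derivable (gradient g) (x + s *: v) v by exact/diff_derivable.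
  rewrite -deriveEjacobian//.
  have dl := is_derive_dotrv v _ _ _ dG.
  rewrite -(@derive_val _ _ _ _ _ _ _ dl).
  exact: is_derive_line.
(* Mean value theorem for [p1]: its derivative is at most [Q], by Cauchy-Schwarz and the Hessian
   bound. *)
have p1le (s : R) : 0 <= s -> p1 s <= p1 0 + Q * s.
  move=> s0.
  have [|c _] := @MVT_segment R p1 _ 0 s s0 (fun r _ => dp1 r).
    apply: derivable_within_continuous => r _; exact: ex_derive.
  rewrite subr0 => /eqP; rewrite subr_eq addrC => /eqP ->.
  rewrite lerD2l ler_wpM2r//.
  apply: le_trans (dotrv_le _ _) _.
  rewrite /Q expr2 mulrCA ler_wpM2l ?enorm_ge0//.
  apply: le_trans (enorm_mulmx_opnorm _ _) _.
  by rewrite ler_wpM2r ?enorm_ge0.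
(* The subtracted quadratic has derivative [p1 0 + Q * s], so [p1le] makes [p0] have nonpositive
   derivative for [s >= 0]; comparing [p0 1] with [p0 0] gives the claim. *)
pose p0 (s : R) := g (x + s *: v) - (p1 0 * s + Q / 2 * s ^+ 2).
have dp0 (s : R) : is_derive s 1 p0 (p1 s - (p1 0 + Q * s)).
  have h1 : is_derive s 1 (fun r : R => g (x + r *: v)) (p1 s).
    by rewrite /p1 -derive_gradient//; apply/is_derive_line/diff_derivable.
  have -> : p0 = (fun r => g (x + r *: v)) -
      (p1 0 \*: (id : R -> R) + (Q / 2) \*: ((id : R -> R) ^+ 2)).
    by apply/funext => r; rewrite /p0 !fctE.
  apply: is_derive_eq; rewrite /= expr1 /GRing.scale/=; lra.
have [|c c01] := @MVT_segment R p0 _ 0 1 ler01 (fun r _ => dp0 r).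
  apply: derivable_within_continuous => r _; exact: ex_derive.
rewrite subr0 mulr1 /p0 scale1r scale0r addr0 => /eqP.
have := p1le c; rewrite (itvP c01) => /(_ isT).
rewrite {2}/p1 scale0r addr0 /Q expr1n expr0n /=.
move=> h /eqP; lra.
Qed.

(** The step 1/L minimises the quadratic bound of [descent_lemma] along the negative gradient: the
    linear term gains |grad|^2 / L and the quadratic term gives back half of it. *)
Lemma gradient_step_decrease {R : realType} {d : nat} (g : 'rV[R]_d -> R)
    (L : R) (x : 'rV[R]_d) :
  0 < L -> twice_differentiable g ->
  (forall y, opnorm (hessian g y) <= L) ->
  g (x - (1 / L) *: gradient g x) <= g x - enorm (gradient g x) ^+ 2 / (2 * L).
Proof.
move=> L0 dg HL; rewrite -scaleNr.
apply: le_trans (descent_lemma _ _ _ _ dg HL) _.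
rewrite enormZ exprMn real_normK ?num_real// sqr_enorm.
have -> : dotrv (- (1 / L) *: gradient g x) (gradient g x) =
    - (1 / L) * dotrv (gradient g x) (gradient g x).
  by rewrite /dotrv mulr_sumr; apply: eq_bigr => i _; rewrite mxE mulrA.
rewrite le_eqVlt; apply/orP; left; apply/eqP; field.
by rewrite gt_eqF.
Qed.

Lemma mean_le_sqrt_mean_sqr {R : rcfType} (a : nat -> R) (m n : nat) (c : R) :
  (m < n)%N -> \sum_(m <= k < n) a k ^+ 2 <= c * (n - m)%:R ->
  1 / (n - m)%:R * \sum_(m <= k < n) a k <= Num.sqrt c.
Proof.
move=> mn ac.
have T0 : 0 < (n - m)%:R :> R by rewrite ltr0n subn_gt0.
(* Nonnegativity of [c] is forced by [ac]; it is what allows [Num.sqrt c] to be squared back to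
   [c]. *)
have c0 : 0 <= c.
  rewrite -(pmulr_lge0 _ T0); apply: le_trans ac.
  by apply: sumr_ge0 => k _; exact: sqr_ge0.
rewrite mul1r mulrC ler_pdivrMr//; apply: le_trans (ler_norm _) _.
rewrite -(@ler_pXn2r _ 2)// ?nnegrE ?mulr_ge0 ?sqrtr_ge0 ?(ltW T0)//.
rewrite real_normK ?num_real// exprMn sqr_sqrtr//.
have := sum_cauchy_schwarz (index_iota m n) a (fun=> 1).
under eq_bigr do rewrite mulr1.
rewrite expr1n sumr_const_nat => /le_trans; apply.
by rewrite [(_ - _)%:R ^+ 2]expr2 mulrA ler_wpM2r// ltW.
Qed.

Theorem theorem1 (R : realType) (d : nat) (f : 'rV[R]_d -> R -> R)
  (xstar : R -> 'rV[R]_d) (h L1 G2 : R) (x : nat -> 'rV[R]_d)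
  (h_gt0 : 0 < h) (L1_gt0 : 0 < L1) (G2_ge0 : 0 <= G2)
  (xstar_min : forall t : R, 0 <= t ->
     forall y : 'rV[R]_d, f (xstar t) t <= f y t)
  (x_tvgd : tvgd f h (1 / L1) x)
  (f_smooth : forall t : R, 0 <= t ->
     twice_differentiable (fun y => f y t) /\
     forall y : 'rV[R]_d, opnorm (hessian (fun z => f z t) y) <= L1)
  (f_time : exists G : R -> R,
     forall (y : 'rV[R]_d) (s t : R), 0 <= s -> 0 <= t ->
       `|(f y s - G s) - (f y t - G t)| <= G2 * `|s - t|)
  (k0 T : nat) (T_gt0 : (0 < T)%N)
  (T_def : T%:R = (f (x k0) (k0%:R * h)
                   - f (xstar (k0%:R * h)) (k0%:R * h)) / (2 * h)) :
  1 / T%:R * (\sum_(k0 <= k < k0 + T)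
     enorm (gradient (fun y => f y (k%:R * h)) (x k)))
  <= 2 * Num.sqrt (L1 * (1 + G2) * h).
Proof.
have [G HG] := f_time.
pose t (k : nat) : R := k%:R * h.
have t_ge0 k : 0 <= t k by rewrite mulr_ge0// ltW.
pose a k := enorm (gradient (fun y => f y (t k)) (x k)).
(* Stated for [n] periods at once: [n = 1] serves the induction below, [n = T] the final
   comparison. *)
have drift y k n : `|(f y (t (k + n)%N) - G (t (k + n)%N)) - (f y (t k) - G (t k))|
    <= G2 * (n%:R * h).
  have -> : n%:R * h = `|t (k + n)%N - t k|.
    by rewrite /t natrD mulrDl addrAC subrr add0r ger0_norm// t_ge0.
  exact: HG.
have decr n : f (x (k0 + n)%N) (t (k0 + n)%N) - G (t (k0 + n)%N)
    + (\sum_(k0 <= k < k0 + n) a k ^+ 2) / (2 * L1)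
    <= f (x k0) (t k0) - G (t k0) + G2 * (n%:R * h).
  elim: n => [|n IH].
    by rewrite addn0 big_geq// mul0r mul0r mulr0 !addr0.
  have step : f (x (k0 + n).+1) (t (k0 + n)%N)
      <= f (x (k0 + n)%N) (t (k0 + n)%N) - a (k0 + n)%N ^+ 2 / (2 * L1).
    rewrite x_tvgd; have [dg Hg] := f_smooth _ (t_ge0 (k0 + n)%N).
    exact: gradient_step_decrease L1_gt0 dg Hg.
  (* After the gradient step at the old time, the new iterate is held fixed while time advances by
     one period. *)
  have := drift (x (k0 + n).+1) (k0 + n)%N 1%N.
  rewrite addn1 ler_norml => /andP[_].
  rewrite addnS big_nat_recr ?leq_addr//= mulrDl -[n.+1]addn1 natrD.
  move: step IH; lra.
have Tf : f (x k0) (t k0) - f (xstar (t k0)) (t k0) = 2 * (T%:R * h).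
  by rewrite T_def; field; rewrite gt_eqF.
have sum_sqr : \sum_(k0 <= k < k0 + T) a k ^+ 2
    <= 4 * (L1 * (1 + G2) * h) * (k0 + T - k0)%:R.
  rewrite addKn.
  have : (\sum_(k0 <= k < k0 + T) a k ^+ 2) / (2 * L1)
      <= 2 * (1 + G2) * (T%:R * h).
    (* The last iterate is carried back to time [t k0] at a second cost G2 T h. There [G (t k0)]
       cancels, and only the optimal value at [t k0] enters, so [Tf] turns the gap into 2 T h. *)
    have := xstar_min _ (t_ge0 k0) (x (k0 + T)%N).
    have := drift (x (k0 + T)%N) k0 T; rewrite ler_norml => /andP[].
    move: (decr T) Tf; lra.
  rewrite ler_pdivrMr ?mulr_gt0// => /le_trans; apply.
  by rewrite le_eqVlt; apply/orP; left; apply/eqP; ring.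
have k0T : (k0 < k0 + T)%N by rewrite -addn1 leq_add2l.
have := mean_le_sqrt_mean_sqr _ _ _ _ k0T sum_sqr.
rewrite addKn sqrtrM// (_ : 4 = 2 ^+ 2) ?sqrtr_sqr ?ger0_norm//.
by rewrite -natrX.
Qed.
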